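(* (Decay at infinity.) Let $n\ge2$, $\alpha\in(0,2)$, let $\Omega_1\subset\{x\in\mathbb{R}^n : x_n\ge0\}$ and let $a:\Omega_1\to\mathbb{R}$ satisfy $$\varliminf_{|x|\to\infty,\ x\in\Omega_1}|x|^{\alpha}a(x)\ge0.$$ Then there exists a constant $R_0>0$, depending on $a$ (and on $n,\alpha$) but not on $\lambda$ or $w$ below, such that the following holds for all $\lambda<0$ with $\Omega_1\subset H_\lambda$. Let $\Omega_2\subset\{x\in H_\lambda : x_n<0\}$ and let $w\in L_\alpha\cap C^{1,\theta}_{loc}(\mathbb{R}^n)$, for some $\theta>\max\{0,\alpha-1\}$, satisfy $$\begin{cases}(-\Delta)^{\frac{\alpha}{2}}w(x)+a(x)w(x)\ge0, & x\in\Omega_1,\\ \mathcal{N}_{\frac{\alpha}{2}}w(x)\ge0, & x\in\Omega_2,\\ w(x)\ge0, & x\in H_\lambda\setminus(\Omega_1\cup\Omega_2),\\ w(x^\lambda)=-w(x), & x\in H_\lambda.\end{cases}$$ If $x_0\in\overline{\Omega_1}$ satisfies $$w(x_0)=\min_{\overline{\Omega_1}}w(x)<0,$$ then $|x_0|\le R_0$.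
   Context: $\mathbb{R}^n_+=\{x=(x_1,\dots,x_n)\in\mathbb{R}^n : x_n>0\}$. For $\lambda\in\mathbb{R}$, $H_\lambda=\{x\in\mathbb{R}^n : x_1<\lambda\}$ and $x^\lambda=(2\lambda-x_1,x_2,\dots,x_n)$ is the reflection of $x$ in the hyperplane $\{x_1=\lambda\}$ (here $x_1$ is a direction tangential to $\partial\mathbb{R}^n_+$, so $x_1\neq x_n$). The fractional Laplacian is $$(-\Delta)^{\frac{\alpha}{2}}w(x)=C_{n,\alpha}\lim_{\epsilon\to0}\int_{\mathbb{R}^n\setminus B_\epsilon(x)}\frac{w(x)-w(y)}{|x-y|^{n+\alpha}}\,dy,$$ where $C_{n,\alpha}>0$ is the usual normalization constant. The nonlocal normal derivative is $$\mathcal{N}_{\frac{\alpha}{2}}w(x)=C_{n,\alpha}\int_{\mathbb{R}^n_+}\frac{w(x)-w(y)}{|x-y|^{n+\alpha}}\,dy,\qquad x_n<0.$$ $L_\alpha=\left\{w:\mathbb{R}^n\to\mathbb{R} : \int_{\mathbb{R}^n}\frac{|w(x)|}{1+|x|^{n+\alpha}}dx<\infty\right\}$. *)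

(* Defs.v *)
(* R^n is ['rV[R]_n], over an arbitrary [R : realType].                       *)
From HB Require Import structures.
From mathcomp Require Import all_boot all_order all_algebra.
From mathcomp Require Import all_classical all_reals all_analysis.

Set Implicit Arguments.
Unset Strict Implicit.
Unset Printing Implicit Defensive.

Import Order.TTheory GRing.Theory Num.Theory.
Import numFieldNormedType.Exports.

Local Open Scope classical_set_scope.
Local Open Scope ring_scope.

Definition measure_rV_display : measure_display.
Proof. exact: default_measure_display. Qed.

(* Borel sigma-algebra of R^n, generated by the coordinate functions.         *)
Section measurable_rV.
Context (R : realType) (n : nat).

Definition rV_coord (i : 'I_n) (x : 'rV[R]_n) : measurableTypeR R := x ord0 i.

Let rV_set0 : g_sigma_preimage rV_coord set0.
Proof. exact: sigma_algebra0. Qed.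

Let rV_setC A : g_sigma_preimage rV_coord A -> g_sigma_preimage rV_coord (~` A).
Proof. exact: sigma_algebraC. Qed.

Let rV_bigcup (F : _^nat) : (forall i, g_sigma_preimage rV_coord (F i)) ->
  g_sigma_preimage rV_coord (\bigcup_i (F i)).
Proof. exact: sigma_algebra_bigcup. Qed.

HB.instance Definition _ := @isMeasurable.Build measure_rV_display
  'rV[R]_n (g_sigma_preimage rV_coord) rV_set0 rV_setC rV_bigcup.

End measurable_rV.

Section measurable_rV_theory.
Context (R : realType) (n : nat).

Lemma measurable_rV_coord (i : 'I_n) :
  measurable_fun [set: 'rV[R]_n] (@rV_coord R n i).
Proof.
move=> _ Y mY; rewrite setTI; apply: sub_sigma_algebra => /=.
rewrite -bigcup_seq/=; exists i => /=; first by rewrite mem_index_enum.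
by exists Y => //; rewrite setTI.
Qed.

Lemma measurable_fun_rV d (T : measurableType d) (f : T -> 'rV[R]_n) :
  (forall i, measurable_fun [set: T] (@rV_coord R n i \o f)) ->
  measurable_fun [set: T] f.
Proof.
move=> mf.
have sub : g_sigma_preimage (fun i => @rV_coord R n i \o f) `<=` measurable.
  apply: smallest_sub; first exact: sigma_algebra_measurable.
  move=> A; rewrite /= -bigcup_seq/= => -[i _] [B mB <-]; exact: mf.
by move=> _ A mA; apply: sub; rewrite g_sigma_preimage_comp; exists A.
Qed.

Definition rV_cons (p : measurableTypeR R * 'rV[R]_n) : 'rV[R]_n.+1 :=
  \row_i oapp (fun j => p.2 ord0 j) p.1 (unlift ord0 i).

Definition rV_uncons (x : 'rV[R]_n.+1) : measurableTypeR R * 'rV[R]_n :=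
  (x ord0 ord0, \row_j x ord0 (lift ord0 j)).

End measurable_rV_theory.

Section measurable_rV_cons.
Context (R : realType) (n : nat).

Lemma rV_consK : cancel (@rV_cons R n) (@rV_uncons R n).
Proof.
move=> [r x]; rewrite /rV_uncons mxE unlift_none/=; congr pair.
by apply/rowP => j; rewrite !mxE liftK.
Qed.

Lemma measurable_rV_cons : measurable_fun [set: _] (@rV_cons R n).
Proof.
apply: measurable_fun_rV => i.
case: (unliftP ord0 i) => [j|] ->.
  rewrite (_ : _ \o _ = @rV_coord R n j \o snd).
    by apply: measurableT_comp => //; exact: measurable_rV_coord.
  by apply/funext => p; rewrite /= /rV_coord mxE liftK.
rewrite (_ : _ \o _ = fst)//.
by apply/funext => p; rewrite /= /rV_coord mxE unlift_none.
Qed.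

Lemma measurable_rV_uncons : measurable_fun [set: _] (@rV_uncons R n).
Proof.
apply: measurable_fun_pair; first exact: (@measurable_rV_coord R n.+1 ord0).
apply: measurable_fun_rV => j.
rewrite (_ : _ \o _ = @rV_coord R n.+1 (lift ord0 j)).
  exact: measurable_rV_coord.
by apply/funext => x; rewrite /= /rV_coord mxE.
Qed.

End measurable_rV_cons.

(* The n.+1-dimensional Lebesgue measure is the product of the 1-dimensional  *)
(* one (first coordinate) with the n-dimensional one (remaining coordinates). *)
Section lebesgue_rV_succ.
Local Open Scope ereal_scope.
Context (R : realType) (n : nat).
Variable mu : {sigma_finite_measure set 'rV[R]_n -> \bar R}.

Let prod_mu := [the {measure set _ -> \bar R} of @lebesgue_measure R \x mu].

Definition lebesgue_rV_succ : set 'rV[R]_n.+1 -> \bar R :=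
  pushforward prod_mu (@rV_cons R n).

HB.instance Definition _ := Measure.copy lebesgue_rV_succ
  (measure_function_pushforward__canonical__measure_function_Measure
    prod_mu (@measurable_rV_cons R n)).

Let lebesgue_rV_succ_sigma_finite : sigma_finite setT lebesgue_rV_succ.
Proof.
have /sigma_finiteP[F [FT ndF Foo]] := sigma_finiteT (@lebesgue_measure R).
have /sigma_finiteP[G [GT ndG Goo]] := sigma_finiteT mu.
exists (fun k => @rV_uncons R n @^-1` (F k `*` G k)).
  rewrite -preimage_bigcup predeqE => x; split=> // _.
  have : [set: measurableTypeR R] (rV_uncons x).1 by [].
  rewrite FT => -[k _ Fk].
  have : [set: 'rV[R]_n] (rV_uncons x).2 by [].
  rewrite GT => -[l _ Gl].
  exists (maxn k l) => //; split.
  - by move: Fk; exact/subsetPset/ndF/leq_maxl.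
  - by move: Gl; exact/subsetPset/ndG/leq_maxr.
move=> k; have [mFk Fk] := Foo k; have [mGk Gk] := Goo k; split.
  rewrite -[X in measurable X]setTI; apply: measurable_rV_uncons => //.
  exact: measurableX.
rewrite /lebesgue_rV_succ /pushforward -comp_preimage.
rewrite (_ : _ \o _ = id) ?preimage_id.
  by rewrite /= product_measure1E// lte_mul_pinfty// ge0_fin_numE.
by apply/funext => p /=; rewrite rV_consK.
Qed.

HB.instance Definition _ := Measure_isSigmaFinite.Build _ _ _ lebesgue_rV_succ
  lebesgue_rV_succ_sigma_finite.

End lebesgue_rV_succ.

Fixpoint lebesgue_rV (R : realType) (n : nat) :
    {sigma_finite_measure set 'rV[R]_n -> \bar R} :=
  if n is m.+1 then lebesgue_rV_succ (lebesgue_rV R m)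
  else \d_(0 : 'rV[R]_0).

(* [`|x|] on ['rV[R]_n] is the sup norm, hence an explicit Euclidean norm.    *)
Definition enorm (R : realType) (n : nat) (x : 'rV[R]_n) : R :=
  Num.sqrt (\sum_(i < n) x ord0 i ^+ 2).

(* In dimension n.+2 the first coordinate has index ord0 and the last one     *)
(* ord_max, so that they are distinct.                                        *)
Section nonlocal.
Context (R : realType) (n : nat).
Local Notation Rn := 'rV[R]_n.+2.
Local Notation mu := (lebesgue_rV R n.+2).

Definition upper_half_space : set Rn := [set x | 0 < x ord0 ord_max].

Definition left_half_space (lambda : R) : set Rn :=
  [set x | x ord0 ord0 < lambda].

Definition reflect_at (lambda : R) (x : Rn) : Rn :=
  \row_i (if i == ord0 then 2 * lambda - x ord0 ord0 else x ord0 i).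

(* C_{n,alpha} = (\int (1 - cos z_1) / |z|^(n + alpha) dz)^-1, the constant   *)
(* for which (-Delta)^(alpha/2) has Fourier symbol |xi|^alpha.                *)
Definition frac_const (alpha : R) : R :=
  (\int[mu]_z ((1 - cos (z ord0 ord0)) / enorm z `^ (n.+2%:R + alpha)))^-1.

Definition frac_laplacian (alpha : R) (w : Rn -> R) (x : Rn) : R :=
  frac_const alpha *
  lim ((fun eps : R => \int[mu]_(y in [set y | eps <= enorm (x - y)])
          ((w x - w y) / enorm (x - y) `^ (n.+2%:R + alpha))) @ 0^'+).

Definition nonlocal_normal_derivative (alpha : R) (w : Rn -> R) (x : Rn) : R :=
  frac_const alpha *
  \int[mu]_(y in upper_half_space)
    ((w x - w y) / enorm (x - y) `^ (n.+2%:R + alpha)).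

Definition L_space (alpha : R) : set (Rn -> R) :=
  [set w : Rn -> R | measurable_fun setT w /\
    (\int[mu]_x (`|w x| / (1 + enorm x `^ (n.+2%:R + alpha)))%:E < +oo)%E].

Definition C1_holder_loc (theta : R) : set (Rn -> R) :=
  [set w | (forall x, differentiable w x) /\
    forall (i : 'I_n.+2) (K : set Rn), compact K ->
      exists M : R, forall x y, K x -> K y ->
        `|'D_(delta_mx ord0 i) w x - 'D_(delta_mx ord0 i) w y|
          <= M * enorm (x - y) `^ theta].

(* Filter "|x| -> oo, x \in D"; it is improper when D is bounded, in which    *)
(* case a lower limit along it is +oo.                                        *)
Definition at_infinity (D : set Rn) : set_system Rn :=
  filter_from [set: R] (fun r => D `&` [set x | r < enorm x]).

End nonlocal.

(* Main.v *)
(* Reflecting y to y^lambda and averaging, the integral over D of            *)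

(* Both operators are handled by one estimate, [antisymmetric_integral_le], for a domain [D] and a
   test set [S] contained in [D] and lying beyond the hyperplane {x_1 = lambda}: only the mass of
   [S] is kept after symmetrization. [le_of_normal_derivative_ge0] uses it with [D] the upper half
   space, to carry the minimum over to Omega2. [frac_laplacian_antisymmetric_le] uses it with [D]
   the exterior of a small ball and passes to the principal value through
   [frac_laplacian_le_local_min]. The bound obtained is uniform in lambda: since the first
   coordinate of x0 is below lambda < 0, the test cube can start at {x_1 = 0} and have side |x0|,
   whatever lambda is. The constant in front of (w x0) |x0|^-alpha thus depends on n and alpha only,
   and R0 is read off from the lower limit of |x|^alpha a(x) before lambda and w are given. *)
(* (w x - w y) / |x - y|^(n + alpha) becomes half the integral of a symmetric *)
(* function, which for antisymmetric w with minimum w x < 0 over the left     *)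
(* half space is at most 2 (w x) |x - y^lambda|^-(n + alpha), because         *)
(* |x - y| <= |x - y^lambda|. For D the upper half space this makes the       *)
(* normal derivative negative at any point of Omega2 where w < w x0, so x0    *)
(* minimizes w over the whole left half space. For D the exterior of a small  *)
(* ball around x0 it bounds (-Delta)^(alpha/2) w x0 by c (w x0) |x0|^-alpha:  *)
(* a cube of side |x0| beyond {x_1 = 0} lies within distance O(|x0|) of x0.   *)
(* Hence 0 <= (w x0) |x0|^-alpha (c + |x0|^alpha a(x0)), which the lower      *)
(* limit of |x|^alpha a(x) forbids for large |x0|. The regularity of w serves *)
(* only to make the principal value converge: at a minimum,                   *)
(* w y - w x0 = O(|y - x0|^(1 + theta)).                                      *)
Require Import Defs.
From HB Require Import structures.
From mathcomp Require Import all_boot all_order all_algebra.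
From mathcomp Require Import all_classical all_reals all_analysis.
From mathcomp Require Import measurable_realfun ring lra.
Import Order.TTheory GRing.Theory Num.Theory.
Import numFieldNormedType.Exports.
Local Open Scope classical_set_scope.
Local Open Scope ring_scope.

Set Implicit Arguments.
Unset Strict Implicit.

(** * Lebesgue measure on row vectors *)

Section measure.
Context (R : realType).

Lemma measurable_box (n : nat) (A : 'I_n -> set (measurableTypeR R)) :
  (forall i, measurable (A i)) ->
  measurable [set x : 'rV[R]_n | forall i, A i (x ord0 i)].
Proof.
move=> mA.
rewrite (_ : [set x | _] = \bigcap_(i in [set` index_enum 'I_n])
  ((@rV_coord R n i) @^-1` A i)).
  rewrite bigcap_seq; apply: bigsetI_measurable => i _.
  by rewrite -[X in measurable X]setTI; exact: measurable_rV_coord.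
apply/seteqP; split => x /= Ax i; first by move=> _; exact: Ax.
by apply: Ax; rewrite /= mem_index_enum.
Qed.

Lemma lebesgue_rV_box (n : nat) (A : 'I_n -> set (measurableTypeR R)) :
  (forall i, measurable (A i)) ->
  (lebesgue_rV R n [set x : 'rV[R]_n | forall i, A i (x ord0 i)] =
   \prod_(i < n) lebesgue_measure (A i))%E.
Proof.
elim: n A => [|n IH] A mA.
  by rewrite big_ord0 /= diracE mem_set// => -[].
rewrite big_ord_recl -(IH (fun i => A (lift ord0 i)))//.
rewrite /= /lebesgue_rV_succ /pushforward.
rewrite (_ : _ @^-1` _ =
  A ord0 `*` [set x : 'rV[R]_n | forall i, A (lift ord0 i) (x ord0 i)]).
  rewrite [LHS](product_measure1E (@lebesgue_measure R) (lebesgue_rV R n))//.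
  exact: (@measurable_box n (fun i => A (lift ord0 i))).
apply/seteqP; split => -[r x] /=.
  move=> H; split => [|i].
    by have := H ord0; rewrite mxE unlift_none.
  by have := H (lift ord0 i); rewrite mxE liftK.
move=> [Ar Ax] i; rewrite mxE.
by case: (unliftP ord0 i) => [j|] -> //=; exact: Ax.
Qed.

Lemma lebesgue_rV_cube (n : nat) (c : 'rV[R]_n) (s : R) : 0 <= s ->
  lebesgue_rV R n [set x : 'rV[R]_n |
     forall i, x ord0 i \in `]c ord0 i, (c ord0 i + s)[ ] = (s ^+ n)%:E.
Proof.
move=> s0.
rewrite (@lebesgue_rV_box n (fun i => `]c ord0 i, (c ord0 i + s)[%classic))//.
under eq_bigr => i _.
  rewrite lebesgue_measure_itv/= lte_fin ltrDl.
  rewrite (_ : (if _ then _ else _) = s%:E); last first.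
    case: ltP => [_|s0']; first by rewrite -EFinB addrAC subrr add0r.
    by congr EFin; apply/le_anti; rewrite s0.
  over.
by rewrite prodEFin big_const_ord iter_mulr_1.
Qed.

Lemma measurable_cube (n : nat) (c : 'rV[R]_n) (s : R) :
  measurable [set x : 'rV[R]_n |
     forall i, x ord0 i \in `]c ord0 i, (c ord0 i + s)[ ].
Proof.
exact: (@measurable_box n (fun i => `]c ord0 i, (c ord0 i + s)[%classic)).
Qed.

Lemma measurable_reflection (c : R) :
  measurable_fun [set: measurableTypeR R]
    (fun r : measurableTypeR R => c - r : measurableTypeR R).
Proof. exact: measurable_funB. Qed.

Lemma lebesgue_measure_reflection (c : R) (A : set (measurableTypeR R)) :
  measurable A ->
  lebesgue_measure ((fun r : R => c - r) @^-1` A) = lebesgue_measure A.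
Proof.
move=> mA.
have mf := measurable_reflection c.
pose nu := measure_function_pushforward__canonical__measure_function_Measure
  (@lebesgue_measure R) mf.
rewrite [LHS](_ : _ = nu A)//.
apply/esym/lebesgue_measure_unique => // X [[a b] _ <-].
rewrite /nu/= /pushforward.
(* The reflection moves the closed end from right to left; the length is unchanged. *)
rewrite (_ : _ @^-1` _ = `[c - b, c - a[%classic); last first.
  by apply/seteqP; split => x /=; rewrite !in_itv/= => /andP[xa xb];
    apply/andP; split; lra.
rewrite !lebesgue_measure_itv/= !lte_fin ltrD2l ltrN2.
case: ifPn => // _; rewrite -!EFinB; congr EFin; lra.
Qed.

Lemma measurable_reflect_at (n : nat) (lambda : R) :
  measurable_fun setT (@reflect_at R n lambda).
Proof.
apply: measurable_fun_rV => i.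
have [->|i0] := eqVneq i ord0.
  rewrite (_ : _ \o _ = fun x : 'rV[R]_n.+2 => 2 * lambda - rV_coord ord0 x).
    by apply: measurable_funB => //; exact: measurable_rV_coord.
  by apply/funext => x; rewrite /= /rV_coord mxE eqxx.
rewrite (_ : _ \o _ = rV_coord i); first exact: measurable_rV_coord.
by apply/funext => x; rewrite /= /rV_coord mxE (negbTE i0).
Qed.

(** The reflection acts only on the first factor of the product measure, so uniqueness of the
    product measure reduces the claim to dimension one. *)
Lemma lebesgue_rV_reflect_at (n : nat) (lambda : R) (A : set 'rV[R]_n.+2) :
  measurable A ->
  lebesgue_rV R n.+2 (reflect_at lambda @^-1` A) = lebesgue_rV R n.+2 A.
Proof.
move=> mA.
pose T : measurableTypeR R * 'rV[R]_n.+1 -> measurableTypeR R * 'rV[R]_n.+1 :=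
  fun p => (2 * lambda - p.1, p.2).
have mT : measurable_fun setT T.
  apply: measurable_fun_pair => //=.
  by apply: (measurableT_comp (measurable_reflection _)).
set mu' := lebesgue_rV R n.+1.
pose nu := measure_function_pushforward__canonical__measure_function_Measure
  [the {measure set _ -> \bar R} of (@lebesgue_measure R \x mu')%E] mT.
have mcA : measurable (@rV_cons R n.+1 @^-1` A).
  by rewrite -[X in measurable X]setTI; exact: measurable_rV_cons.
have E : (@lebesgue_measure R \x mu')%E (@rV_cons R n.+1 @^-1` A) =
    nu (@rV_cons R n.+1 @^-1` A).
  apply: product_measure_unique => // B C mB mC.
  rewrite /nu/= /pushforward.
  rewrite (_ : _ @^-1` _ = ((fun r : R => 2 * lambda - r) @^-1` B) `*` C)//.
  rewrite [LHS](product_measure1E (@lebesgue_measure R) mu') //.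
    by congr (_ * _)%E; exact: lebesgue_measure_reflection.
  by rewrite -[X in measurable X]setTI; exact: measurable_reflection.
rewrite [RHS]E; congr (product_measure1 _ _ _).
apply/seteqP; split => -[r x] /=; rewrite /T/=;
  suff -> : reflect_at lambda (rV_cons (r, x)) = rV_cons (2 * lambda - r, x) by [].
all: apply/rowP => i; rewrite !mxE; case: (unliftP ord0 i) => [j|] -> /=;
  rewrite ?eqxx ?unlift_none ?liftK//=.
Qed.

End measure.

(** * Euclidean norm and dyadic shells *)

Section enorm.
Context (R : realType).

Lemma enorm_ge0 (n : nat) (x : 'rV[R]_n) : 0 <= enorm x.
Proof. exact: sqrtr_ge0. Qed.

Lemma normr_coord_le (n : nat) (x : 'rV[R]_n) i : `|x ord0 i| <= enorm x.
Proof.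
rewrite -sqrtr_sqr /enorm ler_wsqrtr// (bigD1 i)//= lerDl.
by apply: sumr_ge0 => j _; exact: sqr_ge0.
Qed.

Lemma enorm_le_coord (n : nat) (x : 'rV[R]_n) (r : R) :
  (forall i, `|x ord0 i| <= r) -> enorm x <= n%:R * r.
Proof.
case: n x => [|n] x xr.
  by rewrite /enorm big_ord0 sqrtr0 mul0r.
have r0 : 0 <= r by exact: le_trans (xr ord0).
rewrite -[leRHS]ger0_norm ?mulr_ge0// -sqrtr_sqr ler_wsqrtr//.
apply: (@le_trans _ _ (\sum_(i < n.+1) r ^+ 2)).
  by apply: ler_sum => i _; rewrite -real_normK ?num_real// lerXn2r ?nnegrE.
rewrite sumr_const card_ord -[leLHS]mulr_natl exprMn ler_wpM2r ?sqr_ge0//.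
by rewrite -natrX ler_nat leq_pmulr.
Qed.

Lemma enormB (n : nat) (x y : 'rV[R]_n) : enorm (x - y) = enorm (y - x).
Proof.
by congr Num.sqrt; apply: eq_bigr => i _; rewrite !mxE -sqrrN opprB.
Qed.

Lemma enorm0 (n : nat) : enorm (0 : 'rV[R]_n) = 0.
Proof.
by apply/le_anti; rewrite enorm_ge0 -[leRHS](mulr0 n%:R) enorm_le_coord// => i;
  rewrite mxE normr0.
Qed.

Lemma enorm_eq0 (n : nat) (x : 'rV[R]_n) : (enorm x == 0) = (x == 0).
Proof.
apply/eqP/eqP => [x0|->]; last exact: enorm0.
apply/rowP => i; rewrite mxE; apply/eqP; rewrite -normr_le0 -x0.
exact: normr_coord_le.
Qed.

Lemma enorm_gt0 (n : nat) (x : 'rV[R]_n) : (0 < enorm x) = (x != 0).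
Proof. by rewrite lt_def enorm_ge0 andbT enorm_eq0. Qed.

(** The factor [n] is the price of arguing coordinate by coordinate; the estimates below only ask
    for some constant. *)
Lemma enorm_triangle (n : nat) (x y : 'rV[R]_n) :
  enorm y <= n%:R * (enorm x + enorm (x - y)).
Proof.
apply: enorm_le_coord => i.
have -> : y ord0 i = x ord0 i - (x - y) ord0 i by rewrite !mxE; lra.
by rewrite (le_trans (ler_normB _ _))// lerD ?normr_coord_le.
Qed.

Lemma measurable_enormB (n : nat) (x : 'rV[R]_n) :
  measurable_fun setT (fun y : 'rV[R]_n => enorm (x - y)).
Proof.
apply: (@measurableT_comp _ _ _ _ _ _ (@Num.sqrt R) _
  (fun y : 'rV[R]_n => \sum_(i < n) (x - y) ord0 i ^+ 2)).
  by apply: continuous_measurable_fun => ?; exact: sqrt_continuous.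
apply: measurable_sum => i.
apply: measurable_funX.
rewrite (_ : (fun _ => _) = fun y => x ord0 i - rV_coord i y).
  by apply: measurable_funB => //; exact: measurable_rV_coord.
by apply/funext => y; rewrite !mxE.
Qed.

Lemma measurable_enorm (n : nat) :
  measurable_fun setT (fun y : 'rV[R]_n => enorm y).
Proof.
rewrite (_ : (fun _ => _) = fun y : 'rV[R]_n => enorm (0 - y)).
  exact: measurable_enormB.
by apply/funext => y; rewrite enormB subr0.
Qed.

(* [f] is dominated by the sum of the [c k] times the indicators of the cubes  *)
(* of side [4 * r k] around [x].                                               *)
Lemma integrable_shells (n : nat) (x : 'rV[R]_n) (f : 'rV[R]_n -> R)
    (c r : nat -> R) (M q : R) :
  measurable_fun setT f -> (forall y, 0 <= f y) ->
  (forall k, 0 <= c k) -> (forall k, 0 < r k) -> 0 < q < 1 ->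
  (forall y, f y != 0 -> exists2 k, enorm (x - y) <= r k & f y <= c k) ->
  (forall k, c k * (4 * r k) ^+ n <= M * q ^+ k) ->
  (lebesgue_rV R n).-integrable setT (EFin \o f).
Proof.
move=> mf f0 c0 r0 /andP[q0 q1] fcr crM.
have M0 : 0 <= M.
  have := crM 0; rewrite expr0 mulr1; apply: le_trans.
  by rewrite mulr_ge0// exprn_ge0// mulr_ge0// ltW.
(* The half side [2 * r k] exceeds [r k], so that the open cube contains the closed ball of radius
   [r k]. *)
pose Q k := [set y : 'rV[R]_n | forall i, y ord0 i \in
  `]((x - const_mx (2 * r k)) ord0 i),
    ((x - const_mx (2 * r k)) ord0 i + 4 * r k)[ ].
have mQ k : measurable (Q k) by exact: measurable_cube.
apply/integrableP; split; first exact/measurable_EFinP.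
pose g k (y : 'rV[R]_n) : \bar R := (c k * \1_(Q k) y)%:E.
have g0 k y : (0 <= g k y)%E by rewrite lee_fin mulr_ge0.
have mg k : measurable_fun setT (g k).
  apply/measurable_EFinP; apply: measurable_funM => //.
apply: (@le_lt_trans _ _ (\int[lebesgue_rV R n]_y (\sum_(k <oo) g k y))%E).
  apply: ge0_le_integral => //.
  - by apply: measurableT_comp => //; exact/measurable_EFinP.
  - exact: ge0_emeasurable_sum.
  move=> y _; rewrite /= ger0_norm//.
  have [->|/fcr[k xyr fc]] := eqVneq (f y) 0; first exact: nneseries_ge0.
  have yQ : Q k y.
    move=> i /=; have := normr_coord_le (x - y) i.
    move=> /le_trans/(_ xyr); rewrite !mxE ler_norml in_itv/= => /andP[H1 H2].
    by have := r0 k => ?; apply/andP; split; lra.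
  apply: (@le_trans _ _ (\sum_(0 <= i < k.+1) g i y)%E).
    rewrite big_nat_recr//= -[leLHS]add0e leeD//; first exact: sume_ge0.
    by rewrite /g indicE mem_set// mulr1 lee_fin.
  exact: nneseries_lim_ge.
rewrite integral_nneseries//.
apply: (@le_lt_trans _ _ (M * (1 - q)^-1)%:E); last exact: ltry.
apply: lime_le; first by apply: is_cvg_nneseries => k _ _; exact: integral_ge0.
near=> N.
apply: (@le_trans _ _ (\sum_(0 <= k < N) (M * q ^+ k)%:E)%E).
  apply: lee_sum => k _.
  rewrite /g; under eq_integral do rewrite EFinM.
  rewrite ge0_integralZl_EFin//; last first.
    by apply/measurable_EFinP; exact: measurable_indic.
  rewrite integral_indic// setIT.
  rewrite [X in (_ * X)%E](_ : _ = ((4 * r k) ^+ n)%:E); last first.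
    by apply: lebesgue_rV_cube; rewrite mulr_ge0// ltW.
  by rewrite -EFinM lee_fin.
rewrite sumEFin lee_fin; apply: geometric_le_lim => //.
by rewrite gtr0_norm.
Unshelve. all: by end_near. Qed.

End enorm.

(** * Model integrals of powers of the Euclidean norm *)

Section kernel.
Context (R : realType).

Lemma powR_exprn (x p : R) (k : nat) : 0 <= x -> (x ^+ k) `^ p = (x `^ p) ^+ k.
Proof.
move=> x0; elim: k => [|k IH]; first by rewrite !expr0 powR1.
by rewrite !exprS powRM ?exprn_ge0// IH.
Qed.

Lemma powRV (x p : R) : 0 < x -> x^-1 `^ p = (x `^ p)^-1.
Proof.
move=> x0; apply: (@mulIf _ (x `^ p)); first by rewrite gt_eqF ?powR_gt0.
rewrite -powRM ?invr_ge0 ?ltW// mulVf ?gt_eqF// powR1.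
by rewrite mulVf// gt_eqF// powR_gt0.
Qed.

Lemma ler_inv_powR (p s t : R) : 0 <= p -> 0 < s -> s <= t ->
  (t `^ p)^-1 <= (s `^ p)^-1.
Proof.
move=> p0 s0 st; have t0 := lt_le_trans s0 st.
by rewrite lef_pV2 ?posrE ?powR_gt0// ge0_ler_powR ?nnegrE ?(ltW s0) ?(ltW t0).
Qed.

Lemma measurable_powR_enormB (n : nat) (x : 'rV[R]_n) (p : R) :
  measurable_fun setT (fun y : 'rV[R]_n => enorm (x - y) `^ p).
Proof.
exact: (measurableT_comp (measurable_powR p) (measurable_enormB x)).
Qed.

Lemma measurable_invr (n : nat) (f : 'rV[R]_n -> R) :
  (forall y, 0 <= f y) -> measurable_fun setT f ->
  measurable_fun setT (fun y => (f y)^-1).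
Proof.
move=> f0 mf; rewrite (_ : (fun y => _) = fun y => f y `^ (- 1)).
  exact: (measurableT_comp (measurable_powR _) mf).
by apply/funext => y; rewrite powR_inv1.
Qed.

Lemma measurable_enorm_ball (n : nat) (x : 'rV[R]_n) (r : R) :
  measurable [set y : 'rV[R]_n | enorm (x - y) <= r].
Proof.
rewrite (_ : [set y | _] = (fun y => enorm (x - y)) @^-1` `]-oo, r]).
  by rewrite -[X in measurable X]setTI; exact: measurable_enormB.
by apply/seteqP; split => y /=; rewrite in_itv.
Qed.

(** The least [k] with [t <= 2 ^+ k] works: if it is positive, minimality puts its predecessor below
    [t]; the maximum with 1 covers [k = 0]. *)
Lemma dyadic_bracket (t : R) : 0 <= t ->
  exists2 k : nat, t <= 2 ^+ k & 2 ^+ k <= 2 * Num.max 1 t.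
Proof.
move=> t0.
have ex : exists k : nat, t <= 2 ^+ k.
  exists (Num.trunc t).+1; apply: ltW.
  apply: lt_le_trans (truncnS_gt t) _.
  by rewrite -natrX ler_nat ltnW// ltn_expl.
case: (ex_minnP ex) => -[|k] tk mk.
  exists 0%N => //; rewrite expr0; have : 1 <= Num.max 1 t by rewrite le_max lexx.
  lra.
exists k.+1 => //; rewrite exprS ler_wpM2l// le_max; apply/orP; right.
by rewrite leNgt; apply/negP => /ltW /mk; rewrite ltnn.
Qed.

Lemma powRN2_itv (s : R) : 0 < s -> 0 < (2 : R) `^ (- s) < 1.
Proof.
move=> s0; rewrite powR_gt0//= powRN invf_lt1 ?powR_gt0//.
rewrite [ltLHS](_ : 1 = 1 `^ s); last by rewrite powR1.
rewrite gt0_ltr_powR ?nnegrE//.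
lra.
Qed.

Lemma measurable_inv_1DpowR (n : nat) (p : R) :
  measurable_fun setT (fun y : 'rV[R]_n => (1 + enorm y `^ p)^-1).
Proof.
apply: measurable_invr; first by move=> y; rewrite addr_ge0 ?powR_ge0.
apply: measurable_funD => //.
exact: (measurableT_comp (measurable_powR p) (@measurable_enorm R n)).
Qed.

(** On the shell of radius 2^k the function is of order 2^(-k(n + alpha)) and the volume of order
    2^(kn), which leaves a geometric series of ratio 2^-alpha. *)
Lemma integrable_inv_1DpowR (n : nat) (alpha : R) : 0 < alpha ->
  (lebesgue_rV R n).-integrable setT
    (fun y : 'rV[R]_n => ((1 + enorm y `^ (n%:R + alpha))^-1)%:E).
Proof.
move=> a0; set p := n%:R + alpha.
have p0 : 0 < p by rewrite /p ltr_wpDl.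
apply: (@integrable_shells R n 0 (fun y => (1 + enorm y `^ p)^-1)
  (fun k => 2 `^ p / (2 ^+ k) `^ p) (fun k => 2 ^+ k)
  (2 `^ p * 4 ^+ n) (2 `^ (- alpha))).
- exact: measurable_inv_1DpowR.
- by move=> y; rewrite invr_ge0 addr_ge0// powR_ge0.
- by move=> k; rewrite divr_ge0 ?powR_ge0.
- by move=> k; rewrite exprn_gt0.
- exact: powRN2_itv.
- move=> y _; have [k yk ky] := dyadic_bracket (enorm_ge0 y).
  exists k; first by rewrite enormB subr0.
  rewrite ler_pdivlMr ?powR_gt0 ?exprn_gt0// mulrC ler_pdivrMr; last first.
    by rewrite ltr_pwDl// powR_ge0.
  apply: (@le_trans _ _ ((2 * Num.max 1 (enorm y)) `^ p)).
    by rewrite ge0_ler_powR ?nnegrE ?exprn_ge0 ?mulr_ge0 ?le_max ?ler01// ltW.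
  rewrite powRM// ?le_max ?ler01// ler_wpM2l ?powR_ge0//.
  have [_|_] := leP 1 (enorm y); first by rewrite lerDr.
  by rewrite powR1 lerDl powR_ge0.
- move=> k.
  have k0 : 0 < 2 ^+ k :> R by rewrite exprn_gt0.
  have -> : (2 ^+ k) `^ p = (2 ^+ k) ^+ n * (2 ^+ k) `^ alpha :> R.
    by rewrite powRD ?(gt_eqF k0) ?implybT// powR_mulrn// ltW.
  rewrite -(powR_exprn (- alpha)) // powRN exprMn.
  rewrite le_eqVlt; apply/orP; left; apply/eqP.
  have := powR_gt0 alpha k0 => ak.
  by field; rewrite !gt_eqF// exprn_gt0.
Qed.

(** The shells now shrink to [x]: the one of radius 2 / 2^k contributes at most a multiple of
    2^(-ks). Its index comes from bracketing the inverse distance. At [y = x] the function is 0, so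
    that point needs no shell. *)
Lemma integrable_powR_ball (n : nat) (x : 'rV[R]_n) (s : R) : 0 < s ->
  (lebesgue_rV R n).-integrable setT
    (fun y : 'rV[R]_n => (enorm (x - y) `^ s / enorm (x - y) ^+ n *
       \1_[set y | enorm (x - y) <= 1] y)%:E).
Proof.
move=> s0.
apply: (@integrable_shells R n x
  (fun y => enorm (x - y) `^ s / enorm (x - y) ^+ n *
     \1_[set y | enorm (x - y) <= 1] y)
  (fun k => (2 / 2 ^+ k) `^ s * (2 ^+ k) ^+ n) (fun k => 2 / 2 ^+ k)
  (2 `^ s * 8 ^+ n) (2 `^ (- s))).
- apply: measurable_funM; last first.
    by apply: measurable_indic; exact: measurable_enorm_ball.
  apply: measurable_funM; first exact: measurable_powR_enormB.
  apply: measurable_invr; first by move=> y; rewrite exprn_ge0 ?enorm_ge0.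
  by apply: measurable_funX; exact: measurable_enormB.
- by move=> y; rewrite mulr_ge0// divr_ge0 ?powR_ge0// exprn_ge0 ?enorm_ge0.
- by move=> k; rewrite mulr_ge0 ?powR_ge0 ?exprn_ge0.
- by move=> k; rewrite divr_gt0// exprn_gt0.
- exact: powRN2_itv.
- move=> y; rewrite indicE; have [/set_mem/= y1|] := boolP (y \in _); last first.
    by rewrite mulr0 eqxx.
  rewrite mulr1 => H.
  have y0 : 0 < enorm (x - y).
    rewrite lt_def enorm_ge0 andbT; apply: contra_neq H => ->.
    by rewrite powR0 ?gt_eqF// mul0r.
  have [|k yk ky] := @dyadic_bracket (enorm (x - y))^-1.
    by rewrite invr_ge0 ltW.
  have k0 : 0 < 2 ^+ k :> R by rewrite exprn_gt0.
  rewrite max_r in ky; last by rewrite invf_ge1.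
  have xk : enorm (x - y) <= 2 / 2 ^+ k.
    by rewrite ler_pdivlMr// -ler_pdivlMl// mulrC.
  exists k => //.
  apply: ler_pM.
  - exact: powR_ge0.
  - by rewrite invr_ge0 exprn_ge0// ltW.
  - by rewrite ge0_ler_powR ?nnegrE ?(ltW s0) ?divr_ge0 ?(ltW y0) ?(ltW k0).
  - by rewrite -exprVn lerXn2r ?nnegrE ?invr_ge0 ?(ltW y0) ?(ltW k0).
- move=> k.
  have k0 : 0 < 2 ^+ k :> R by rewrite exprn_gt0.
  rewrite -(powR_exprn (- s)) // powRN powRM ?invr_ge0 ?(ltW k0)//.
  rewrite powRV//.
  rewrite le_eqVlt; apply/orP; left; apply/eqP.
  have -> : 4 * (2 / 2 ^+ k) = 8 / 2 ^+ k :> R by field; rewrite gt_eqF.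
  rewrite !exprMn exprVn.
  by field; rewrite !gt_eqF// ?powR_gt0// exprn_gt0.
Qed.

End kernel.

(** * Integrability of the difference quotient *)

Section tail.
Context (R : realType).

(** At distance at least [delta] from [x] one has |y| <= K |x - y|, so the kernel is controlled by
    the weight that defines [L_space]. *)
Lemma kernel_tail_le (n : nat) (p delta : R) (x : 'rV[R]_n) : 0 < p -> 0 < delta ->
  exists2 C, 0 <= C & forall y, delta <= enorm (x - y) ->
    (enorm (x - y) `^ p)^-1 <= C * (1 + enorm y `^ p)^-1.
Proof.
move=> p0 d0; set K := n%:R * (enorm x / delta + 1).
have K0 : 0 <= K.
  by rewrite mulr_ge0// addr_ge0// divr_ge0 ?enorm_ge0 ?(ltW d0).
exists ((delta `^ p)^-1 + K `^ p) => [|y dxy].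
  by rewrite addr_ge0 ?invr_ge0 ?powR_ge0.
have t0 : 0 < enorm (x - y) by exact: lt_le_trans dxy.
have tp0 : 0 < enorm (x - y) `^ p by rewrite powR_gt0.
have dp0 : 0 < delta `^ p by rewrite powR_gt0.
have y0 : 0 < 1 + enorm y `^ p.
  by apply: ltr_pwDl; [exact: ltr01|exact: powR_ge0].
rewrite (ler_pdivlMr _ _ y0) mulrC (ler_pdivrMr _ _ tp0) mulrDl; apply: lerD.
  rewrite mulrC ler_pdivlMr// mul1r.
  by rewrite ge0_ler_powR ?nnegrE ?(ltW p0) ?(ltW d0) ?(ltW t0).
rewrite -powRM ?(ltW t0)//.
have Kt0 : 0 <= K * enorm (x - y) by rewrite mulr_ge0 ?(ltW t0).
rewrite ge0_ler_powR ?nnegrE ?(ltW p0) ?enorm_ge0 ?Kt0//.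
apply: le_trans (enorm_triangle x y) _.
rewrite /K -mulrA ler_wpM2l// mulrDl mul1r lerD2r.
by rewrite mulrAC ler_pdivlMr// ler_wpM2l ?enorm_ge0.
Qed.

Lemma measurable_diff_quotient (n : nat) (p c : R) (w : 'rV[R]_n -> R) x :
  measurable_fun setT w ->
  measurable_fun setT (fun y => (c - w y) / enorm (x - y) `^ p).
Proof.
move=> mw; apply: measurable_funM; first exact: measurable_funB.
apply: measurable_invr; first by move=> y; exact: powR_ge0.
exact: measurable_powR_enormB.
Qed.

(** Away from [x], bound |w x - w y| by |w x| + |w y|: the weight of [L_space] integrates the
    constant as well as [w]. *)
Lemma integrable_diff_quotient (n : nat) (alpha delta : R)
    (w : 'rV[R]_n.+2 -> R) (x : 'rV[R]_n.+2) (D : set 'rV[R]_n.+2) :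
  0 < alpha -> 0 < delta -> L_space alpha w -> measurable D ->
  (forall y, D y -> delta <= enorm (x - y)) ->
  (lebesgue_rV R n.+2).-integrable D
    (EFin \o (fun y => (w x - w y) / enorm (x - y) `^ (n.+2%:R + alpha))).
Proof.
move=> a0 d0 [mw iw] mD Dd.
set p := n.+2%:R + alpha; have p0 : 0 < p by rewrite addr_gt0.
have [C C0 HC] := kernel_tail_le x p0 d0.
have i1 := integrable_inv_1DpowR n.+2 a0; rewrite -/p in i1.
have i2 : (lebesgue_rV R n.+2).-integrable setT
    (fun y => (`|w y| / (1 + enorm y `^ p))%:E).
  apply/integrableP; split.
    apply/measurable_EFinP; apply: measurable_funM.
      exact: measurableT_comp.
    exact: measurable_inv_1DpowR.
  under eq_integral => y _.
    rewrite gee0_abs; last by rewrite lee_fin divr_ge0// addr_ge0// powR_ge0.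
    over.
  exact: iw.
have i3 : (lebesgue_rV R n.+2).-integrable D
    (fun y => C%:E * (`|w x|%:E * ((1 + enorm y `^ p)^-1)%:E +
       (`|w y| / (1 + enorm y `^ p))%:E))%E.
  apply: (integrableS (E := setT)) => //.
  apply: integrableZl => //; apply: integrableD => //.
  exact: integrableZl.
apply: le_integrable i3 => //.
  apply/measurable_EFinP; apply: measurable_funTS.
  exact: measurable_diff_quotient.
move=> y Dy /=; rewrite lee_fin.
have y0 : 0 <= (1 + enorm y `^ p)^-1 by rewrite invr_ge0 addr_ge0// powR_ge0.
rewrite -mulrDl normrM [in leRHS]ger0_norm; last first.
  by rewrite mulr_ge0// mulr_ge0// addr_ge0.
rewrite [`| _^-1|]ger0_norm ?invr_ge0 ?powR_ge0//.
rewrite mulrCA; apply: ler_pM => //; first by rewrite invr_ge0 powR_ge0.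
- exact: ler_normB.
- exact: HC (Dd _ Dy).
Qed.

Lemma sin_normr_le (t : R) : `|sin t| <= `|t|.
Proof.
wlog t0 : t / 0 <= t => [H|].
  have [|/ltW t0] := leP 0 t; first exact: H.
  by rewrite -normrN -sinN -(normrN t); apply: H; rewrite oppr_ge0.
have [|c _ E] := @MVT_segment R sin cos 0 t t0.
  by apply: continuous_subspaceT => u; exact: continuous_sin.
move: E; rewrite sin0 !subr0 => ->.
by rewrite normrM ler_piMl// cos_max.
Qed.

Lemma onem_cos_le (t : R) : 1 - cos t <= t ^+ 2.
Proof.
wlog t0 : t / 0 <= t => [H|].
  have [|/ltW t0] := leP 0 t; first exact: H.
  by rewrite -cosN -sqrrN; apply: H; rewrite oppr_ge0.
have [|c] := @MVT_segment R cos (fun u => - sin u) 0 t t0.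
  by apply: continuous_subspaceT => u; exact: continuous_cos.
rewrite in_itv/= => /andP[c0 ct]; rewrite cos0 subr0 => E.
rewrite -opprB E mulNr opprK expr2 ler_wpM2r//.
apply: le_trans (ler_norm _) _; apply: le_trans (sin_normr_le _) _.
by rewrite ger0_norm.
Qed.

(* A divergent integral would have [Rintegral] 0 and make the constant 0.      *)
Lemma frac_const_gt0 (n : nat) (alpha : R) : 0 < alpha < 2 ->
  0 < frac_const n alpha.
Proof.
move=> /andP[a0 a2]; rewrite /frac_const invr_gt0.
set p := n.+2%:R + alpha; have p0 : 0 < p by rewrite addr_gt0.
have s0 : 0 < 2 - alpha by rewrite subr_gt0.
set f := fun z : 'rV[R]_n.+2 => (1 - cos (z ord0 ord0)) / enorm z `^ p.
have f0 z : 0 <= f z by rewrite divr_ge0 ?powR_ge0// subr_ge0 cos_le1.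
have mf : measurable_fun setT f.
  apply: measurable_funM.
    apply: measurable_funB => //.
    apply: (@measurableT_comp _ _ _ _ _ _ cos).
      by apply: continuous_measurable_fun; exact: continuous_cos.
    exact: measurable_rV_coord.
  apply: measurable_invr; first by move=> y; exact: powR_ge0.
  exact: (measurableT_comp (measurable_powR p) (@measurable_enorm R _)).
(* In the unit ball 1 - cos z_1 <= |z|^2 leaves the power 2 - alpha minus the dimension. Outside it
   the numerator is at most 2 and |z|^-p is at most 2 / (1 + |z|^p), whence the factor 4. *)
have fi : (lebesgue_rV R n.+2).-integrable setT (EFin \o f).
  have i1 := integrable_inv_1DpowR n.+2 a0; rewrite -/p in i1.
  have i2 := integrable_powR_ball 0 s0 (n := n.+2).
  have := integrableD measurableT i2 (integrableZl measurableT 4 i1).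
  apply: le_integrable => //; first exact/measurable_EFinP.
  move=> y _ /=; rewrite lee_fin ger0_norm//.
  rewrite enormB subr0 indicE.
  have [->|y0] := eqVneq y 0.
    by rewrite /f mxE cos0 subrr mul0r.
  have e0 : 0 < enorm y by rewrite enorm_gt0.
  have ep0 : 0 < enorm y `^ p by rewrite powR_gt0.
  have K0 : 0 <= (1 + enorm y `^ p)^-1 by rewrite invr_ge0 addr_ge0// ltW.
  have [/set_mem/= y1|/negP y1] := boolP (y \in _).
    rewrite mulr1 ger0_norm; last first.
      apply: addr_ge0; last exact: mulr_ge0.
      by rewrite divr_ge0 ?powR_ge0 ?exprn_ge0 ?(ltW e0).
    apply: ler_wpDr; first exact: mulr_ge0.
    rewrite /f /p powRD ?(gt_eqF e0) ?implybT// powR_mulrn ?(ltW e0)//.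
    rewrite powRB ?(gt_eqF e0) ?implybT// powR_mulrn ?(ltW e0)// invfM.
    rewrite mulrA mulrAC ler_wpM2r ?invr_ge0 ?exprn_ge0 ?(ltW e0)//.
    rewrite ler_wpM2r ?invr_ge0 ?powR_ge0//.
    apply: le_trans (onem_cos_le _) _.
    rewrite -real_normK ?num_real// lerXn2r ?nnegrE ?(ltW e0)//.
    exact: normr_coord_le.
  rewrite mulr0 add0r ger0_norm; last first.
    exact: mulr_ge0.
  have {}y1 : 1 < enorm y.
    by rewrite ltNge; apply/negP => H; apply: y1; rewrite inE/= enormB subr0.
  have ep1 : 1 <= enorm y `^ p.
    rewrite [leLHS](_ : 1 = 1 `^ p); last by rewrite powR1.
    by rewrite ge0_ler_powR ?nnegrE ?(ltW p0) ?(ltW e0) ?(ltW y1).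
  rewrite ler_pdivrMr// mulrAC ler_pdivlMr ?ltr_pwDl ?(ltW ep0)//.
  have : 1 - cos (y ord0 ord0) <= 2 by have := cos_geN1 (y ord0 ord0) => ?; lra.
  have : 0 <= 1 - cos (y ord0 ord0) by rewrite subr_ge0 cos_le1.
  nra.
(* On the cube where all coordinates lie between pi/2 and pi, cos z_1 <= 0, so the integrand is at
   least the constant [m]. *)
pose c : 'rV[R]_n.+2 := const_mx (pi / 2).
pose Q := [set x : 'rV[R]_n.+2 |
     forall i, x ord0 i \in `]c ord0 i, (c ord0 i + pi / 2)[ ].
have mQ : measurable Q by exact: measurable_cube.
have pi2 : 0 < pi / 2 :> R by rewrite divr_gt0// pi_gt0.
pose m := ((n.+2%:R * pi) `^ p)^-1.
have m0 : 0 < m by rewrite invr_gt0 powR_gt0// mulr_gt0// pi_gt0.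
apply: (@lt_le_trans _ _ (\int[lebesgue_rV R n.+2]_(z in Q) m)).
  rewrite Rintegral_cst// mulr_gt0//.
  rewrite [X in fine X](_ : _ = ((pi / 2) ^+ n.+2)%:E) ?exprn_gt0//.
  by apply: lebesgue_rV_cube; exact: ltW.
have mf_le z : ((fun=> m) \_ Q) z <= f z.
  rewrite /patch; case: ifPn => [/set_mem Qz|_]; last exact: f0.
  have zb i : 0 <= z ord0 i - pi / 2 <= pi / 2.
    have := Qz i; rewrite /c in_itv/= !mxE => /andP[z1 z2].
    by apply/andP; split; lra.
  have cos0 : cos (z ord0 ord0) <= 0.
    rewrite -(subrK (pi / 2) (z ord0 ord0)) cosDpihalf oppr_le0.
    apply: sin_ge0_pi; have /andP[z1 z2] := zb ord0; apply/andP; split; lra.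
  have z0 : 0 < enorm z.
    apply: lt_le_trans (normr_coord_le z ord0).
    by rewrite normr_gt0 gt_eqF//; have /andP[z1 z2] := zb ord0; lra.
  have zp0 : 0 < enorm z `^ p by rewrite powR_gt0.
  have np0 : 0 < n.+2%:R * pi :> R by rewrite mulr_gt0// pi_gt0.
  rewrite /f /m ler_pdivlMr// ler_pdivrMl ?powR_gt0//.
  apply: (@le_trans _ _ ((n.+2%:R * pi) `^ p)); last first.
    by rewrite ler_peMr ?powR_ge0// lerBrDr gerDl.
  rewrite ge0_ler_powR ?nnegrE ?(ltW p0) ?(ltW z0) ?(ltW np0)//.
  apply: enorm_le_coord => i; have /andP[z1 z2] := zb i.
  by rewrite ler_norml; apply/andP; split; lra.
rewrite Rintegral_mkcond; apply: le_Rintegral => //.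
apply: le_integrable fi => //.
  by apply/measurable_EFinP; apply/(measurable_restrictT _ _).1.
move=> z _ /=; rewrite lee_fin !ger0_norm// /patch.
by case: ifP => // _; exact: ltW.
Qed.

End tail.

(** * Antisymmetric functions *)

Section indic.
Context d (T : measurableType d) (R : realType).

Lemma Rintegral_indic (mu : {measure set T -> \bar R}) (S : set T) (v : R) :
  measurable S -> mu S = v%:E ->
  mu.-integrable setT (EFin \o (\1_S : T -> R)) /\ \int[mu]_y \1_S y = v.
Proof.
move=> mS muS; have E : (\int[mu]_y (\1_S y)%:E = v%:E)%E.
  by rewrite integral_indic// setIT.
split; last by rewrite /Rintegral E.
apply/integrableP; split; first exact/measurable_EFinP/measurable_indic.
under eq_integral => y _ do rewrite /= ger0_norm//.
by rewrite E ltry.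
Qed.

(* Meant for [g' = g \o reflect_at lambda]: averaging over the reflection      *)
(* avoids splitting the domain along the hyperplane.                           *)
Lemma Rintegral_le_symmetrized (mu : {measure set T -> \bar R})
    (g g' s s' : T -> R) (c v : R) :
  mu.-integrable setT (EFin \o g) -> mu.-integrable setT (EFin \o g') ->
  mu.-integrable setT (EFin \o s) -> mu.-integrable setT (EFin \o s') ->
  \int[mu]_y g' y = \int[mu]_y g y ->
  \int[mu]_y s y = v -> \int[mu]_y s' y = v ->
  (forall y, g y + g' y <= c * (s y + s' y)) ->
  \int[mu]_y g y <= c * v.
Proof.
move=> ig ig' is_ is' Eg Es Es' le.
have iss := integrableD measurableT is_ is'.
have : \int[mu]_y (g y + g' y) <= \int[mu]_y (c * (s y + s' y)).
  apply: le_Rintegral => //; first exact: (integrableD measurableT ig ig').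
  exact: (integrableZl measurableT c iss).
rewrite RintegralD// RintegralZl// RintegralD// Eg Es Es'.
lra.
Qed.

End indic.

Section antisymmetry.
Context (R : realType) (n : nat).
Local Notation mu := (lebesgue_rV R n.+2).

Lemma reflect_atK (lambda : R) : involutive (@reflect_at R n lambda).
Proof.
move=> x; apply/rowP => i; rewrite !mxE eqxx.
by case: eqP => [->|//]; lra.
Qed.

Lemma reflect_at_left (lambda : R) (y : 'rV[R]_n.+2) : lambda < y ord0 ord0 ->
  left_half_space lambda (reflect_at lambda y).
Proof. by rewrite /left_half_space/= mxE eqxx => ?; lra. Qed.

Lemma enorm_reflect_at_ge (lambda : R) (x y : 'rV[R]_n.+2) :
  left_half_space lambda x -> left_half_space lambda y ->
  enorm (x - y) <= enorm (x - reflect_at lambda y).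
Proof.
rewrite /left_half_space/= => xl yl.
rewrite ler_wsqrtr//; apply: ler_sum => i _; rewrite !mxE.
by case: eqP => [->|//]; nra.
Qed.

Lemma integrable_reflect_at (lambda : R) (g : 'rV[R]_n.+2 -> R) :
  mu.-integrable setT (EFin \o g) ->
  mu.-integrable setT (EFin \o (g \o reflect_at lambda)) /\
  \int[mu]_y g (reflect_at lambda y) = \int[mu]_y g y.
Proof.
move=> ig.
have mrho := @measurable_reflect_at R n lambda.
(* The reflection preserves the measure, so the change of variables is integration against the
   pushforward. *)
have E (f : 'rV[R]_n.+2 -> \bar R) :
    (\int[pushforward mu (reflect_at lambda)]_y f y = \int[mu]_y f y)%E.
  apply: eq_measure_integral => A mA _.
  exact: lebesgue_rV_reflect_at.
have mg : measurable_fun setT (EFin \o g) by exact: measurable_int ig.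
have igr : mu.-integrable setT (EFin \o (g \o reflect_at lambda)).
  apply/integrableP; split; first exact: measurableT_comp mg mrho.
  have := ge0_integral_pushforward mrho mu measurableT
    (measurableT_comp (@abse_measurable R setT) mg) (fun _ _ => abse_ge0 _).
  rewrite preimage_setT => <-; rewrite E.
  by case/integrableP : ig.
split=> //.
have H : (\int[mu]_y (EFin \o (g \o reflect_at lambda)) y =
  \int[mu]_y (EFin \o g) y)%E.
  have := integral_pushforward mrho mg igr measurableT.
  by rewrite preimage_setT => <-; exact: E.
exact: (congr1 fine H).
Qed.

(** Take [y] on the left. If [y] is in [D], then w x - w y <= 0, and replacing the kernel at [y] by
    the smaller one at the reflected point can only raise the sum, which becomes twice w x times
    that kernel. If only the reflected point is in [D], the sign of [w y] gives the same bound; this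
    occurs when [D] is the exterior of a ball around [x] and [y] lies in the ball. Points on the
    right follow by exchanging [y] with its reflection, and on the hyperplane [w] vanishes. *)
Lemma antisymmetric_pointwise_le (p lambda delta m : R)
    (w : 'rV[R]_n.+2 -> R) (x : 'rV[R]_n.+2) (D S : set 'rV[R]_n.+2) :
  0 <= p -> 0 < delta ->
  (forall y, D y -> delta <= enorm (x - y)) ->
  (forall y, left_half_space lambda y -> w (reflect_at lambda y) = - w y) ->
  (forall y : 'rV[R]_n.+2, y ord0 ord0 = lambda -> w y = 0) ->
  left_half_space lambda x -> w x <= 0 ->
  (forall y, left_half_space lambda y -> D y ->
     D (reflect_at lambda y) /\ w x <= w y) ->
  (forall y, left_half_space lambda y -> ~ D y -> D (reflect_at lambda y) ->
     w y <= 0) ->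
  S `<=` D -> (forall y, S y -> lambda < y ord0 ord0) ->
  (forall y, S y -> m <= (enorm (x - y) `^ p)^-1) ->
  let g := (fun y => (w x - w y) / enorm (x - y) `^ p) \_ D in
  forall y, g y + g (reflect_at lambda y) <=
    w x * m * (\1_S y + \1_S (reflect_at lambda y)).
Proof.
move=> p0 d0 Dd anti w0 xl wx wD wND SD Sr mk g.
set k := fun y : 'rV[R]_n.+2 => (enorm (x - y) `^ p)^-1 in mk *.
have k0 y : 0 <= k y by rewrite invr_ge0 powR_ge0.
have gD y : D y -> g y = (w x - w y) * k y by move=> Dy; rewrite /g /patch mem_set.
have gND y : ~ D y -> g y = 0 by move=> Dy; rewrite /g /patch memNset.
have S0 y : ~ S y -> \1_S y = 0 :> R by move=> Sy; rewrite indicE memNset.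
have left_case y : left_half_space lambda y ->
    g y + g (reflect_at lambda y) <= w x * m * (\1_S y + \1_S (reflect_at lambda y)).
  move=> yl.
  rewrite (S0 y) ?add0r; last by move=> /Sr; rewrite ltNge (ltW yl).
  have kS : w x * k (reflect_at lambda y) <= w x * m * \1_S (reflect_at lambda y).
    rewrite -mulrA ler_wnM2l// indicE.
    case: (boolP (reflect_at lambda y \in S)) => [/set_mem Sy|_]; rewrite ?mulr1 ?mulr0//.
    exact: mk.
  have [Dy|Dy] := pselect (D y).
    have [Dry wxy] := wD _ yl Dy.
    have xy0 : 0 < enorm (x - y) by exact: lt_le_trans (Dd _ Dy).
    have xyr := enorm_reflect_at_ge xl yl.
    have krho : k (reflect_at lambda y) <= k y by exact: ler_inv_powR.
    rewrite !gD// anti// opprK; apply: le_trans kS.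
    apply: (@le_trans _ _ ((w x - w y) * k (reflect_at lambda y) +
      (w x + w y) * k (reflect_at lambda y))).
      by rewrite lerD2r ler_wnM2l// subr_le0.
    (* The two factors add up to twice [w x]; one copy, being nonpositive, is dropped so that both
       cases share one bound. *)
    rewrite -mulrDl; apply: (ler_wpM2r (k0 _)).
    by rewrite addrACA addNr addr0 gerDl.
  have [Dry|Dry] := pselect (D (reflect_at lambda y)); last first.
    by rewrite !gND// S0 ?mulr0 ?addr0// => /SD.
  rewrite gND// gD// add0r anti// opprK; apply: le_trans kS.
  by rewrite ler_wpM2r// gerDl wND.
move=> y.
have [yl|yl|yl] := ltgtP (y ord0 ord0) lambda.
- exact: left_case.
- have := left_case (reflect_at lambda y) (reflect_at_left yl).
  rewrite (reflect_atK lambda y) => H.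
  by rewrite [leLHS]addrC [X in _ <= _ * X]addrC.
- have -> : reflect_at lambda y = y.
    by apply/rowP => i; rewrite mxE; case: eqP => // ->; lra.
  rewrite (S0 y) ?addr0 ?mulr0; last by move=> /Sr; rewrite yl ltxx.
  have [Dy|Dy] := pselect (D y); last by rewrite gND// addr0.
  by rewrite gD// (w0 y)// subr0 -mulrDr mulr_le0_ge0// addr_ge0.
Qed.

Lemma antisymmetric_integral_le (alpha lambda delta m v : R)
    (w : 'rV[R]_n.+2 -> R) (x : 'rV[R]_n.+2) (D S : set 'rV[R]_n.+2) :
  0 < alpha -> 0 < delta -> L_space alpha w -> measurable D ->
  (forall y, D y -> delta <= enorm (x - y)) ->
  (forall y, left_half_space lambda y -> w (reflect_at lambda y) = - w y) ->
  (forall y : 'rV[R]_n.+2, y ord0 ord0 = lambda -> w y = 0) ->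
  left_half_space lambda x -> w x <= 0 ->
  (forall y, left_half_space lambda y -> D y ->
     D (reflect_at lambda y) /\ w x <= w y) ->
  (forall y, left_half_space lambda y -> ~ D y -> D (reflect_at lambda y) ->
     w y <= 0) ->
  measurable S -> mu S = v%:E -> S `<=` D ->
  (forall y, S y -> lambda < y ord0 ord0) ->
  (forall y, S y -> m <= (enorm (x - y) `^ (n.+2%:R + alpha))^-1) ->
  \int[mu]_(y in D) ((w x - w y) / enorm (x - y) `^ (n.+2%:R + alpha)) <=
  w x * m * v.
Proof.
move=> a0 d0 Lw mD Dd anti w0 xl wx wD wND mS muS SD Sr mk.
have p0 : 0 <= n.+2%:R + alpha by rewrite addr_ge0// ltW.
have := antisymmetric_pointwise_le p0 d0 Dd anti w0 xl wx wD wND SD Sr mk.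
rewrite Rintegral_mkcond; set g := _ \_ D => /= pointwise.
have ig : mu.-integrable setT (EFin \o g).
  have := integrable_diff_quotient a0 d0 Lw mD Dd.
  by move/(integrable_mkcond _ mD); rewrite restrict_EFin.
have [igr Er] := integrable_reflect_at lambda ig.
have [iS ES] := Rintegral_indic mS muS.
have [iSr ESr] := integrable_reflect_at lambda iS.
exact: (Rintegral_le_symmetrized ig igr iS iSr Er ES (etrans ESr ES) pointwise).
Qed.

End antisymmetry.

(** * Interior minima *)

Section local_min.
Context (R : realType) (n : nat).

Lemma is_derive_line (w : 'rV[R]_n.+2 -> R) (x v : 'rV[R]_n.+2) (t : R) :
  differentiable w (x + t *: v) ->
  is_derive t (1 : R) (fun s : R => w (x + s *: v)) ('D_v w (x + t *: v)).
Proof.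
move=> dw.
have E : (fun h : R => h^-1 *:
    (((fun s : R => w (x + s *: v)) \o shift t) (h *: 1) - w (x + t *: v)))
  = (fun h : R => h^-1 *: ((w \o shift (x + t *: v)) (h *: v) - w (x + t *: v))).
  apply/funext => h /=; congr (_ *: (w _ - _)).
  by rewrite scalerDl addrA addrAC -scalerA scale1r [RHS]addrC addrAC.
apply: DeriveDef.
  by rewrite /derivable E; exact: diff_derivable.
by rewrite /derive E.
Qed.

Lemma derive_coord_sum (w : 'rV[R]_n.+2 -> R) (z v : 'rV[R]_n.+2) :
  differentiable w z ->
  'D_v w z = \sum_i v ord0 i * 'D_(delta_mx ord0 i) w z.
Proof.
move=> dw; rewrite deriveE// {1}(row_sum_delta v) linear_sum.
by apply: eq_bigr => i _; rewrite linearZ/= deriveE.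
Qed.

Lemma enormZ (x : 'rV[R]_n.+2) (c : R) : enorm (c *: x) = `|c| * enorm x.
Proof.
rewrite /enorm -sqrtr_sqr -sqrtrM ?sqr_ge0// mulr_sumr.
by congr Num.sqrt; apply: eq_bigr => i _; rewrite !mxE exprMn.
Qed.

(** The gradient vanishes at the minimum, so at a point of the segment from [x] to [y] it is O(|y -
    x|^theta) by the Hoelder condition; the mean value theorem supplies the remaining power of |y -
    x|. *)
Lemma local_min_holder (theta r : R) (w : 'rV[R]_n.+2 -> R) (x : 'rV[R]_n.+2) :
  0 < r -> 0 <= theta -> C1_holder_loc theta w ->
  (forall y, enorm (x - y) < r -> w x <= w y) ->
  exists2 M, 0 <= M & forall y, enorm (x - y) < r ->
    w y - w x <= M * enorm (x - y) `^ (1 + theta).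
Proof.
move=> r0 th0 [dw hw] wmin.
have Dx0 i : 'D_(delta_mx ord0 i) w x = 0.
  set e := delta_mx ord0 i.
  have dphi (t : R) :
      is_derive t (1 : R) (fun s : R => w (x + s *: e)) ('D_e w (x + t *: e)).
    exact: is_derive_line.
  have := @derive1_at_min R (fun s : R => w (x + s *: e)) (- r) r 0.
  have -> : 'D_e w x = 'D_e w (x + 0 *: e) by rewrite scale0r addr0.
  move=> H; have := @derive_val _ _ _ _ _ _ _ (dphi 0) => <-.
  apply: derive_val; apply: H.
  - lra.
  - by move=> t _; have [] := dphi t.
  - by rewrite in_itv/=; apply/andP; split; lra.
  - move=> t; rewrite in_itv/= => tr; rewrite scale0r addr0; apply: wmin.
    rewrite opprD addNKr -scaleNr enormZ normrN.
    suff -> : enorm e = 1 by rewrite mulr1 ltr_norml.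
    rewrite /enorm (bigD1 i)//= big1 ?addr0 => [|j ji].
      by rewrite mxE !eqxx expr1n sqrtr1.
    by rewrite mxE (negbTE ji) andbF expr0n.
pose K := [set z : 'rV[R]_n.+2 |
  forall i, `[x ord0 i - r, x ord0 i + r]%classic (z ord0 i)].
have cK : compact K.
  apply: (@rV_compact R n.+2 (fun i => `[x ord0 i - r, x ord0 i + r]%classic)).
  by move=> i; exact: segment_compact.
have KE z : enorm (x - z) <= r -> K z.
  move=> xz i; have := le_trans (normr_coord_le (x - z) i) xz.
  by rewrite !mxE ler_norml /= in_itv/= => /andP[? ?]; apply/andP; split; lra.
have /choice[M HM] : forall i, exists M, forall y z, K y -> K z ->
  `|'D_(delta_mx ord0 i) w y - 'D_(delta_mx ord0 i) w z|
          <= M * enorm (y - z) `^ theta.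
  by move=> i; exact: hw cK.
exists (\sum_i `|M i|); first exact: sumr_ge0.
move=> y xy; set v := y - x.
have ev : enorm (x - y) = enorm v by rewrite enormB.
have [|c c01] := @MVT_segment R (fun s => w (x + s *: v))
  (fun s => 'D_v w (x + s *: v)) 0 1 ler01 (fun c _ => is_derive_line (dw _)).
  apply: continuous_subspaceT => s; apply: differentiable_continuous.
  by apply/derivable1_diffP; have [] := is_derive_line (dw (x + s *: v)).
have -> : w (x + 1 *: v) = w y by rewrite scale1r addrC subrK.
rewrite scale0r addr0 subr0 mulr1 => ->.
rewrite derive_coord_sum// mulr_suml.
have /andP[c0 c1] : 0 <= c <= 1 by move: c01; rewrite in_itv.
have xz : enorm (x + c *: v - x) <= enorm v.
  by rewrite addrAC subrr add0r enormZ ger0_norm// ler_piMl// enorm_ge0.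
apply: ler_sum => i _.
apply: (le_trans (ler_norm _)); rewrite normrM ev.
have [v0|v0] := eqVneq (enorm v) 0.
  have -> : v ord0 i = 0.
    by move/eqP : v0; rewrite enorm_eq0 => /eqP ->; rewrite mxE.
  by rewrite normr0 mul0r mulr_ge0// powR_ge0.
rewrite powRD ?v0 ?implybT// powRr1 ?enorm_ge0// mulrCA.
apply: ler_pM => //; first exact: normr_coord_le.
have := HM i (x + c *: v) x; rewrite Dx0 subr0 => /(_ _ _)/le_trans; apply.
- by apply: KE; rewrite enormB (le_trans xz)// -ev ltW.
- by apply: KE; rewrite subrr enorm0 ltW.
apply: (le_trans (ler_wpM2r (powR_ge0 _ _) (ler_norm (M i)))).
apply: ler_wpM2l; first exact: normr_ge0.
by rewrite ge0_ler_powR ?nnegrE ?enorm_ge0.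
Qed.

End local_min.

Section restrict.
Context d (T : measurableType d) (R : realType).
Variable mu : {measure set T -> \bar R}.

Lemma le_Rintegral_restrict (f : T -> R) (A B : set T) :
  measurable A -> measurable B -> mu.-integrable setT (EFin \o f) ->
  (forall y, (f \_ A) y <= (f \_ B) y) ->
  \int[mu]_(y in A) f y <= \int[mu]_(y in B) f y.
Proof.
move=> mA mB fi fAB; rewrite (Rintegral_mkcond _ A) (Rintegral_mkcond _ B).
apply: le_Rintegral => //.
  rewrite -restrict_EFin; apply/(integrable_mkcond _ mA).
  exact: integrableS fi.
rewrite -restrict_EFin; apply/(integrable_mkcond _ mB).
exact: integrableS fi.
Qed.

(** The lower bound does not depend on [A], which bounds all truncated integrals at once. *)
Lemma Rintegral_restrict_ge (f : T -> R) (A : set T) :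
  measurable A -> mu.-integrable setT (EFin \o f) ->
  - (\int[mu]_y `|f y|) <= \int[mu]_(y in A) f y.
Proof.
move=> mA fi.
have fiA : mu.-integrable A (EFin \o f) by exact: integrableS fi.
rewrite lerNl; apply: (le_trans (ler_norm _)); rewrite normrN.
apply: (le_trans (le_normr_Rintegral mA fiA)).
apply: le_Rintegral_restrict => //; first exact: integrable_norm.
by move=> y; rewrite patch_setT /patch; case: ifP => _ //; exact: normr_ge0.
Qed.

Lemma integrable_split (f h : T -> R) (A : set T) :
  measurable A -> measurable_fun setT f -> mu.-integrable A (EFin \o f) ->
  mu.-integrable setT (EFin \o h) -> (forall y, ~ A y -> `|f y| <= `|h y|) ->
  mu.-integrable setT (EFin \o f).
Proof.
move=> mA mf fi hi fh.
have fiA : mu.-integrable setT (EFin \o (f \_ A)).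
  by rewrite -restrict_EFin; apply/(integrable_mkcond _ mA).
have := integrableD measurableT (integrable_norm fiA) (integrable_norm hi).
apply: le_integrable => //; first exact/measurable_EFinP.
move=> y _ /=; rewrite lee_fin [leRHS]ger0_norm ?addr_ge0// /patch.
have [/set_mem Ay|/negP Ay] := boolP (y \in A); first by rewrite lerDl.
by rewrite normr0 add0r; apply: fh => /mem_set.
Qed.

End restrict.

Section frac_laplacian.
Context (R : realType) (n : nat).
Local Notation mu := (lebesgue_rV R n.+2).

Lemma measurable_enorm_exterior (x : 'rV[R]_n.+2) (r : R) :
  measurable [set y : 'rV[R]_n.+2 | r <= enorm (x - y)].
Proof.
rewrite (_ : [set y | _] = (fun y => enorm (x - y)) @^-1` `[r, +oo[).
  by rewrite -[X in measurable X]setTI; exact: measurable_enormB.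
by apply/seteqP; split => y /=; rewrite in_itv/= andbT.
Qed.

(** Near [x] the quotient is O(|x - y|^(1 + theta - alpha)) divided by |x - y| to the dimension,
    which is integrable because theta > alpha - 1; far from [x] membership in [L_space] suffices. *)
Lemma integrable_local_min (alpha theta r : R) (w : 'rV[R]_n.+2 -> R)
    (x : 'rV[R]_n.+2) :
  0 < alpha -> Num.max 0 (alpha - 1) < theta -> 0 < r ->
  L_space alpha w -> C1_holder_loc theta w ->
  (forall y, enorm (x - y) < r -> w x <= w y) ->
  mu.-integrable setT
    (EFin \o (fun y => (w x - w y) / enorm (x - y) `^ (n.+2%:R + alpha))).
Proof.
move=> a0; rewrite gt_max => /andP[th0 tha] r0 Lw Cw wmin.
set p := n.+2%:R + alpha.
have s0 : 0 < 1 + theta - alpha by lra.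
have [M M0 HM] := local_min_holder r0 (ltW th0) Cw wmin.
pose r' := Num.min r 1.
have r'0 : 0 < r' by rewrite lt_min r0 ltr01.
have ball0 := integrableZl measurableT M (integrable_powR_ball x s0).
apply: (integrable_split (measurable_enorm_exterior x r') _ _ ball0).
- by apply: measurable_diff_quotient; case: Lw.
- apply: (integrable_diff_quotient a0 r'0 Lw) => //.
  exact: measurable_enorm_exterior.
move=> y /= /negP; rewrite -ltNge lt_min => /andP[xyr xy1].
have [xy0|xy0] := eqVneq (enorm (x - y)) 0.
  have -> : y = x by move/eqP : xy0; rewrite enorm_eq0 subr_eq0 => /eqP.
  by rewrite subrr mul0r normr0.
have e0 : 0 < enorm (x - y) by rewrite lt_def xy0 enorm_ge0.
rewrite indicE mem_set/= ?(ltW xy1)// mulr1.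
rewrite normrM ler0_norm ?subr_le0 ?wmin// opprB ger0_norm ?invr_ge0 ?powR_ge0//.
rewrite [leRHS]ger0_norm ?mulr_ge0 ?invr_ge0 ?powR_ge0 ?exprn_ge0 ?enorm_ge0//.
apply: (@le_trans _ _ (M * enorm (x - y) `^ (1 + theta) / enorm (x - y) `^ p)).
  by rewrite ler_wpM2r ?invr_ge0 ?powR_ge0// HM.
have -> : enorm (x - y) `^ p = enorm (x - y) ^+ n.+2 * enorm (x - y) `^ alpha.
  by rewrite powRD ?xy0 ?implybT// powR_mulrn ?enorm_ge0.
by rewrite powRB ?xy0 ?implybT// invfM [_^-1 * _^-1]mulrC !mulrA.
Qed.

(** Near a minimum the integrand is nonpositive, so shrinking [eps] only lowers the truncated
    integrals. Being bounded below, they converge to their infimum; [lim] is therefore a genuine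
    limit and not a default value, and any single truncation bounds it from above. *)
Lemma frac_laplacian_le_local_min (alpha theta r b : R) (w : 'rV[R]_n.+2 -> R)
    (x : 'rV[R]_n.+2) :
  0 < alpha < 2 -> Num.max 0 (alpha - 1) < theta -> 0 < r ->
  L_space alpha w -> C1_holder_loc theta w ->
  (forall y, enorm (x - y) < r -> w x <= w y) ->
  (forall eps, 0 < eps < r ->
     \int[mu]_(y in [set y | eps <= enorm (x - y)])
       ((w x - w y) / enorm (x - y) `^ (n.+2%:R + alpha)) <= b) ->
  frac_laplacian alpha w x <= frac_const n alpha * b.
Proof.
move=> a02 th r0 Lw Cw wmin Ib.
have a0 : 0 < alpha by case/andP : a02.
have fi := integrable_local_min a0 th r0 Lw Cw wmin.
rewrite /frac_laplacian ler_wpM2l ?(ltW (frac_const_gt0 n a02))//.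
set f := fun y => (w x - w y) / enorm (x - y) `^ (n.+2%:R + alpha) in fi *.
set I := fun eps : R => _.
have lb eps : - (\int[mu]_y `|f y|) <= I eps.
  exact: (Rintegral_restrict_ge (measurable_enorm_exterior x eps) fi).
have ndI : {in `]0, r[ &, nondecreasing_fun I}.
  move=> e1 e2 _ e2r e12.
  apply: (le_Rintegral_restrict (measurable_enorm_exterior x e1)
    (measurable_enorm_exterior x e2) fi) => y.
  rewrite /patch; case: ifPn => [/set_mem/= xe1|/negP xe1];
    case: ifPn => [/set_mem//= xe2|/negP xe2] //.
    rewrite /f mulr_le0_ge0 ?invr_ge0 ?powR_ge0// subr_le0 wmin//.
    move: e2r; rewrite in_itv/= => /andP[_]; apply: le_lt_trans.
    by rewrite leNgt; apply/negP => /ltW xe2'; apply: xe2; rewrite inE.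
  by case: xe1; rewrite inE/=; exact: le_trans e12 xe2.
have cI := @nondecreasing_at_right_cvgr R I 0 (BLeft r) r0 ndI.
have hlb : has_lbound (I @` `]0, r[).
  by exists (- (\int[mu]_y `|f y|)) => _ [e _ <-].
rewrite (cvg_lim _ (cI hlb))//.
apply: (@le_trans _ _ (I (r / 2))); last by apply: Ib; apply/andP; split; lra.
apply: ge_inf => //; exists (r / 2) => //=.
by rewrite in_itv/=; apply/andP; split; lra.
Qed.

End frac_laplacian.

(** * Strict sign of the two operators at negative minima *)

Section decay.
Context (R : realType) (n : nat).
Local Notation mu := (lebesgue_rV R n.+2).

(** Antisymmetry is assumed on the open half space only. The points at distance t on either side of
    [y] along the first axis are reflections of each other, so their values cancel; let t tend to
    0. *)
Lemma antisymmetric_eq0 (lambda : R) (w : 'rV[R]_n.+2 -> R) (y : 'rV[R]_n.+2) :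
  (forall x, differentiable w x) ->
  (forall x, left_half_space lambda x -> w (reflect_at lambda x) = - w x) ->
  y ord0 ord0 = lambda -> w y = 0.
Proof.
move=> dw anti yl; pose e : 'rV[R]_n.+2 := delta_mx ord0 ord0.
have cw (v : 'rV[R]_n.+2) : w (y + t *: v) @[t --> (0 : R)^'+] --> w y.
  apply: cvg_at_right_filter.
  have [dv _] := is_derive_line (dw (y + (0 : R) *: v)).
  have : {for 0, continuous (fun s : R => w (y + s *: v))}.
    by apply: differentiable_continuous; apply/derivable1_diffP.
  by rewrite /prop_for/continuous_at scale0r addr0.
have c2 : w (y + t *: e) + w (y + t *: - e) @[t --> (0 : R)^'+] --> w y + w y.
  by apply: cvgD; exact: cw.
have c0 : w (y + t *: e) + w (y + t *: - e) @[t --> (0 : R)^'+] --> (0 : R).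
  apply: cvg_near_cst; near=> t.
  have t0 : 0 < t by near: t; exact: nbhs_right_gt.
  have -> : y + t *: e = reflect_at lambda (y + t *: - e).
    apply/rowP => i; rewrite !mxE eqxx; case: eqP => [->|_] /=.
      by rewrite yl /=; lra.
    by rewrite ?mulr0n ?oppr0.
  by rewrite anti ?addNr// /left_half_space/= !mxE !eqxx yl/=; lra.
have : w y + w y = 0 by exact: (cvg_unique _ c2 c0).
lra.
Unshelve. all: by end_near. Qed.

Lemma nonpos_ball (w : 'rV[R]_n.+2 -> R) (x : 'rV[R]_n.+2) :
  {for x, continuous w} -> w x < 0 ->
  exists2 r, 0 < r & forall y, enorm (x - y) < r -> w y <= 0.
Proof.
move=> cw wx0.
have : \forall y \near x, w y < 0 by exact: (cvgr_lt _ cw).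
move=> /nbhs_ballP[r /= r0 rw]; exists r => // y xy; apply/ltW/rw; split=> // i j.
rewrite ord1 /ball/=; apply: le_lt_trans xy.
by have := normr_coord_le (x - y) j; rewrite !mxE.
Qed.

Lemma closure_coord_approx (A : set 'rV[R]_n.+2) (x : 'rV[R]_n.+2) (e : R) :
  closure A x -> 0 < e ->
  exists2 y, A y & forall i, `|x ord0 i - y ord0 i| < e.
Proof.
move=> Ax e0; have [y [Ay xy]] := Ax _ (nbhsx_ballx x e e0).
by exists y => // i; case: xy => _; exact.
Qed.

Lemma limf_einf_at_infinity_ge0 (f : 'rV[R]_n.+2 -> R)
    (D : set 'rV[R]_n.+2) (c : R) :
  0 < c -> (0 <= limf_einf (fun x => (f x)%:E) (at_infinity D))%E ->
  exists r, forall x, D x -> r < enorm x -> - c < f x.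
Proof.
move=> c0; rewrite limf_einfE => /(@lt_le_trans _ _ _ (- c)%:E _).
rewrite lte_fin oppr_lt0 => /(_ c0)/ereal_sup_gt[_ [V [r _ rV] <-]] cV.
exists r => x Dx rx; rewrite -lte_fin; apply: lt_le_trans cV _.
by apply: ereal_inf_lbound; exists x => //; exact: rV.
Qed.

(** By contraposition: if [w x < u], then [w x] is negative and below [w] on the left part of the
    upper half space. That half space is invariant under the reflection and at distance at least
    -x_n from [x], so the symmetrized integral converges and is strictly negative. *)
Lemma le_of_normal_derivative_ge0 (alpha lambda u : R)
    (w : 'rV[R]_n.+2 -> R) (x : 'rV[R]_n.+2) :
  0 < alpha < 2 -> L_space alpha w ->
  (forall y, left_half_space lambda y -> w (reflect_at lambda y) = - w y) ->
  (forall y : 'rV[R]_n.+2, y ord0 ord0 = lambda -> w y = 0) ->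
  left_half_space lambda x -> x ord0 ord_max < 0 -> u <= 0 ->
  (forall y, left_half_space lambda y -> @upper_half_space R n y -> u <= w y) ->
  0 <= nonlocal_normal_derivative alpha w x -> u <= w x.
Proof.
move=> a02 Lw anti w0 xl xn u0 wu; apply: contraTT; rewrite -!ltNge => wxu.
have a0 : 0 < alpha by case/andP : a02.
rewrite /nonlocal_normal_derivative pmulr_rlt0 ?frac_const_gt0//.
have ord_max0 : (ord_max : 'I_n.+2) == ord0 = false by [].
(* Strict negativity only asks for a test set of positive volume: a unit cube in the upper half
   space, just beyond the hyperplane. Below, [q] bounds |x - y| on it. *)
pose c : 'rV[R]_n.+2 := \row_i (if i == ord0 then lambda else 0).
pose S := [set y : 'rV[R]_n.+2 |
     forall i, y ord0 i \in `]c ord0 i, (c ord0 i + 1)[ ].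
have muS : mu S = 1%:E by rewrite -[1 in RHS](expr1n _ n.+2); exact: lebesgue_rV_cube.
pose q := n.+2%:R * (enorm x + `|lambda| + 1).
have q0 : 0 < q by rewrite mulr_gt0// ltr_wpDl// addr_ge0// enorm_ge0.
pose p := n.+2%:R + alpha.
have p0 : 0 < p by rewrite addr_gt0.
apply: (@le_lt_trans _ _ (w x * (q `^ p)^-1 * 1)); last first.
  rewrite mulr1 nmulr_rlt0 ?invr_gt0 ?powR_gt0//; exact: lt_le_trans u0.
have wx0 : w x <= 0 by rewrite ltW// (lt_le_trans wxu).
have mU : measurable (@upper_half_space R n).
  rewrite (_ : @upper_half_space R n = rV_coord ord_max @^-1` `]0, +oo[).
    by rewrite -[X in measurable X]setTI; exact: measurable_rV_coord.
  by apply/seteqP; split => y; rewrite /= in_itv/= andbT.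
have d0 : 0 < - x ord0 ord_max by rewrite oppr_gt0.
have Ud (y : 'rV[R]_n.+2) : @upper_half_space R n y -> - x ord0 ord_max < enorm (x - y).
  rewrite /upper_half_space/= => y0.
  apply: lt_le_trans (normr_coord_le _ ord_max); rewrite !mxE ltr_normr.
  by apply/orP; right; lra.
have Sy0 y : S y -> lambda < y ord0 ord0 < lambda + 1.
  by move=> /(_ ord0); rewrite !mxE eqxx in_itv.
have Syi y i : S y -> i != ord0 -> 0 < y ord0 i < 1.
  by move=> /(_ i) + /negbTE i0; rewrite !mxE i0 in_itv/= add0r.
have SU : S `<=` @upper_half_space R n.
  by move=> y /(Syi _ ord_max)/(_ isT)/andP[].
apply: (antisymmetric_integral_le a0 d0 Lw mU _ anti w0 xl wx0 _ _
  (measurable_cube c 1) muS SU).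
- by move=> y /Ud/ltW.
- move=> y yl yU; split; last by rewrite (le_trans (ltW wxu))// wu.
  by rewrite /upper_half_space/= mxE ord_max0.
- by move=> y yl yU; rewrite /upper_half_space/= mxE ord_max0 => /yU.
- by move=> y /Sy0/andP[].
move=> y Sy.
have xy0 : 0 < enorm (x - y) by exact: lt_trans (Ud _ (SU _ Sy)).
apply: (ler_inv_powR (ltW p0) xy0).
apply: enorm_le_coord => i.
have := normr_coord_le x i.
rewrite !mxE !ler_norml => /andP[x1 x2].
have := ler_norm lambda; have := ler_norm (- lambda); rewrite normrN => l1 l2.
have [i0|i0] := eqVneq i ord0.
  by move: x1 x2; rewrite i0; have /andP[? ?] := Sy0 _ Sy => ? ?; apply/andP; split; lra.
by have /andP[? ?] := Syi _ _ Sy i0; apply/andP; split; lra.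
Qed.

(** The test cube of side r = |x| lies beyond {x_1 = 0}, and each coordinate of x - y is at most 2r
    on it. Its volume, r to the dimension, against a kernel of order r to minus (dimension + alpha)
    leaves r^-alpha with a constant free of lambda. *)
Lemma frac_laplacian_antisymmetric_le (alpha lambda theta : R)
    (w : 'rV[R]_n.+2 -> R) (x : 'rV[R]_n.+2) :
  0 < alpha < 2 -> Num.max 0 (alpha - 1) < theta -> lambda < 0 ->
  L_space alpha w -> C1_holder_loc theta w ->
  (forall y, left_half_space lambda y -> w (reflect_at lambda y) = - w y) ->
  (forall y : 'rV[R]_n.+2, y ord0 ord0 = lambda -> w y = 0) ->
  left_half_space lambda x -> w x < 0 ->
  (forall y, left_half_space lambda y -> w x <= w y) ->
  frac_laplacian alpha w x <=
  frac_const n alpha / (2 * n.+2%:R) `^ (n.+2%:R + alpha) *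
    (w x / enorm x `^ alpha).
Proof.
move=> a02 th l0 Lw Cw anti w0 xl wx0 wmin.
have a0 : 0 < alpha by case/andP : a02.
pose p := n.+2%:R + alpha; have p0 : 0 < p by rewrite addr_gt0.
pose r := enorm x.
have x0r : - r <= x ord0 ord0.
  by have := normr_coord_le x ord0; rewrite ler_norml => /andP[].
have xl0 : x ord0 ord0 < lambda by exact: xl.
have r0 : 0 < r by lra.
pose c : 'rV[R]_n.+2 := \row_i (if i == ord0 then 0 else x ord0 i).
pose S := [set y : 'rV[R]_n.+2 |
     forall i, y ord0 i \in `]c ord0 i, (c ord0 i + r)[ ].
have muS : mu S = (r ^+ n.+2)%:E by apply: lebesgue_rV_cube; exact: ltW.
have [rho rho0 wrho] := nonpos_ball (differentiable_continuous (Cw.1 x)) wx0.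
pose q := n.+2%:R * (2 * r).
have q0 : 0 < q by rewrite mulr_gt0// mulr_gt0.
have d0 : 0 < lambda - x ord0 ord0 by rewrite subr_gt0.
(* Below [rho] the removed ball carries only nonpositive values of [w]; below the distance to the
   hyperplane it stays on the left, so the reflection of a left point is never removed. *)
pose r' := Num.min rho (lambda - x ord0 ord0).
have r'0 : 0 < r' by rewrite lt_min rho0 d0.
have in_left y : enorm (x - y) < lambda - x ord0 ord0 -> left_half_space lambda y.
  move=> /(le_lt_trans (normr_coord_le (x - y) ord0)).
  by rewrite !mxE ltr_norml /left_half_space/= => /andP[? ?]; lra.
have far (y : 'rV[R]_n.+2) : lambda < y ord0 ord0 ->
    lambda - x ord0 ord0 < enorm (x - y).
  move=> ly; apply: lt_le_trans (normr_coord_le _ ord0); rewrite !mxE ltr_normr.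
  by apply/orP; right; lra.
have Sy0 y : S y -> 0 < y ord0 ord0 < r.
  by move=> /(_ ord0); rewrite !mxE eqxx in_itv/= add0r.
have Syi y i : S y -> i != ord0 -> x ord0 i < y ord0 i < x ord0 i + r.
  by move=> /(_ i) + /negbTE i0; rewrite !mxE i0 in_itv.
have Sl y : S y -> lambda < y ord0 ord0 by move=> /Sy0/andP[? ?]; lra.
have -> : frac_const n alpha / (2 * n.+2%:R) `^ p * (w x / enorm x `^ alpha) =
    frac_const n alpha * (w x * (q `^ p)^-1 * r ^+ n.+2).
  have -> : q `^ p = (2 * n.+2%:R) `^ p * (r ^+ n.+2 * r `^ alpha).
    have -> : q = 2 * n.+2%:R * r by rewrite /q; lra.
    rewrite powRM ?(ltW r0)//; congr (_ * _).
    by rewrite powRD ?(gt_eqF r0) ?implybT// powR_mulrn// ltW.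
  rewrite -/r; field.
  by rewrite !gt_eqF ?powR_gt0 ?exprn_gt0 // mulr_gt0.
apply: (@frac_laplacian_le_local_min R n alpha theta r' _ w x a02 th r'0 Lw Cw)
  => [y|eps /andP[eps0]].
  by rewrite lt_min => /andP[_ /in_left]; exact: wmin.
rewrite lt_min => /andP[epsrho epsl].
apply: (antisymmetric_integral_le a0 eps0 Lw (measurable_enorm_exterior x eps) _
  anti w0 xl (ltW wx0) _ _ (measurable_cube c r) muS) => //.
- move=> y yl _; split; last exact: wmin.
  apply: (le_trans (ltW epsl)); rewrite -(reflect_atK lambda y) in yl.
  apply/ltW/far; move: yl; rewrite /left_half_space/= !mxE eqxx => ?; lra.
- by move=> y yl /negP; rewrite -ltNge => ye _; apply: wrho; exact: lt_trans epsrho.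
- by move=> y /Sl/far ?; rewrite /= ltW// (lt_trans epsl).
move=> y Sy.
have xy0 : 0 < enorm (x - y) by exact: lt_trans (far _ (Sl _ Sy)).
apply: (ler_inv_powR (ltW p0) xy0).
apply: enorm_le_coord => i.
rewrite !mxE ler_norml.
have [i0|i0] := eqVneq i ord0.
  by rewrite i0; have /andP[? ?] := Sy0 _ Sy; apply/andP; split; lra.
by have /andP[? ?] := Syi _ _ Sy i0; apply/andP; split; lra.
Qed.

End decay.

Unset Implicit Arguments.
Set Strict Implicit.

Theorem lemma1 (R : realType) (n : nat) (alpha : R)
    (halpha : 0 < alpha < 2)
    (Omega1 : set 'rV[R]_n.+2)
    (hOmega1 : Omega1 `<=` [set x : 'rV[R]_n.+2 | 0 <= x ord0 ord_max])
    (a : 'rV[R]_n.+2 -> R)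
    (ha : (0 <= limf_einf (fun x => (enorm x `^ alpha * a x)%:E)
                  (at_infinity Omega1))%E) :
  exists2 R0 : R, 0 < R0 &
    forall (lambda : R), lambda < 0 ->
    Omega1 `<=` left_half_space lambda ->
    forall (Omega2 : set 'rV[R]_n.+2),
    Omega2 `<=` left_half_space lambda `&`
      [set x : 'rV[R]_n.+2 | x ord0 ord_max < 0] ->
    forall (w : 'rV[R]_n.+2 -> R) (theta : R),
    Num.max 0 (alpha - 1) < theta ->
    L_space alpha w ->
    C1_holder_loc theta w ->
    (forall x, Omega1 x -> 0 <= frac_laplacian alpha w x + a x * w x) ->
    (forall x, Omega2 x -> 0 <= nonlocal_normal_derivative alpha w x) ->
    (forall x, (left_half_space lambda `\` (Omega1 `|` Omega2)) x ->
       0 <= w x) ->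
    (forall x, left_half_space lambda x ->
       w (reflect_at lambda x) = - w x) ->
    forall x0 : 'rV[R]_n.+2,
    closure Omega1 x0 ->
    (forall x, closure Omega1 x -> w x0 <= w x) ->
    w x0 < 0 ->
    enorm x0 <= R0.
Proof.
have /andP[a0 _] := halpha.
(* This constant involves neither [lambda] nor [w], so the radius [r1] it determines can be fixed
   first. *)
pose c := frac_const n alpha / (2 * n.+2%:R) `^ (n.+2%:R + alpha).
have c0 : 0 < c by rewrite divr_gt0 ?frac_const_gt0// powR_gt0// mulr_gt0.
have [r1 Hr1] := limf_einf_at_infinity_ge0 c0 ha.
(* The maximum with 1 makes the radius positive and later keeps [x0] away from the origin, where
   |x0|^alpha would vanish. *)
exists (Num.max r1 1); first by rewrite lt_max ltr01 orbT.
move=> lambda l0 O1l Omega2 O2 w theta th Lw Cw hL hN hpos anti x0 x0cl x0min wx0.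
rewrite leNgt; apply/negP; rewrite gt_max => /andP[r1x x1].
have dw := Cw.1.
have w0 (y : 'rV[R]_n.+2) : y ord0 ord0 = lambda -> w y = 0.
  exact: antisymmetric_eq0.
have x0n : 0 <= x0 ord0 ord_max.
  rewrite leNgt; apply/negP => x0n.
  have [|y /hOmega1/= yn /(_ ord_max)] :=
    closure_coord_approx x0cl (e := - x0 ord0 ord_max).
    by rewrite oppr_gt0.
  by rewrite ltr_norml => /andP[? _]; lra.
have x0l : left_half_space lambda x0.
  rewrite /left_half_space/= lt_neqAle; apply/andP; split.
    by apply/eqP => /w0 wx0E; rewrite wx0E ltxx in wx0.
  rewrite leNgt; apply/negP => x0l.
  have [|y /O1l yl /(_ ord0)] :=
    closure_coord_approx x0cl (e := x0 ord0 ord0 - lambda).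
    by rewrite subr_gt0.
  by rewrite /left_half_space/= in yl; rewrite ltr_norml => /andP[_ ?]; lra.
(* The minimum is attained in the closure. Outside Omega1, [x0] would fall under the sign condition,
   because its last coordinate being nonnegative keeps it out of Omega2. *)
have O1x0 : Omega1 x0.
  apply: contrapT => NO1; suff : 0 <= w x0 by rewrite leNgt wx0.
  apply: hpos; split => // -[//|/O2[_]] /=; rewrite ltNge.
  by rewrite x0n.
have half y : left_half_space lambda y -> ~ Omega2 y -> w x0 <= w y.
  move=> yl NO2; have [yO1|NO1] := pselect (Omega1 y).
    exact/x0min/subset_closure.
  by rewrite (le_trans (ltW wx0))// hpos//; split => // -[].
(* The upper half space misses Omega2, so [half] provides the comparison that the normal derivative
   argument requires at points of Omega2. *)
have wmin y : left_half_space lambda y -> w x0 <= w y.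
  move=> yl; have [yO2|] := pselect (Omega2 y); last exact: half.
  apply: (le_of_normal_derivative_ge0 halpha Lw anti w0 yl _ (ltW wx0) _ (hN _ yO2)).
    by case: (O2 _ yO2).
  move=> z zl zU; apply: half => // /O2[_] /=.
  by rewrite ltNge; move: zU; rewrite /upper_half_space/= => /ltW ->.
have frac_le :=
  frac_laplacian_antisymmetric_le halpha th l0 Lw Cw anti w0 x0l wx0 wmin.
rewrite -/c in frac_le.
set E := enorm x0 `^ alpha in frac_le.
have E0 : 0 < E by rewrite powR_gt0// (lt_trans ltr01).
have := hL _ O1x0; apply/negP; rewrite -ltNge.
apply: le_lt_trans (lerD frac_le (lexx _)) _.
(* The first factor is negative, and the second is positive because |x0| > [r1]; this contradicts
   the inequality at [x0]. *)
have -> : c * (w x0 / E) + a x0 * w x0 = w x0 / E * (c + E * a x0).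
  by field; rewrite gt_eqF.
rewrite nmulr_rlt0; last by rewrite pmulr_llt0 ?invr_gt0.
by rewrite -ltrBlDl sub0r Hr1.
Qed.
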